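(* Let $L$ be a line in $\mathbb{P}^n$, with associated finite set of points $Z\subset\mathbb{P}W^*$. (i) If $|Z|=2$, then $L^{\circ2}$ is a line in $\mathbb{P}^n$. (ii) If $|Z|>2$, then $L^{\circ2}$ is a smooth conic in $\mathbb{P}^n$.
   Context: We work over $\mathbb{C}$. $L^{\circ2}$ denotes the coordinate-wise square of $L$: the image of $L$ under the morphism $\varphi_2\colon\mathbb{P}^n\to\mathbb{P}^n$, $[x_0:\ldots:x_n]\mapsto[x_0^2:\ldots:x_n^2]$. The line $L$ is viewed as the image of a chosen linear embedding $[\ell_0:\ldots:\ell_n]\colon\mathbb{P}W\hookrightarrow\mathbb{P}^n$, where $W$ is a $2$-dimensional vector space and $\ell_0,\ldots,\ell_n\in W^*$ are linear forms; the associated finite set of points is $Z:=\{[\ell_i]\in\mathbb{P}W^*\mid 0\le i\le n,\ \ell_i\ne0\}$ (as a set, without repetitions). A smooth conic in $\mathbb{P}^n$ is a smooth plane conic contained in some plane inside $\mathbb{P}^n$. *)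

(* Defs.v *)
From HB Require Import structures.
From mathcomp Require Import all_boot all_order all_algebra.
From mathcomp Require Import finmap complex.
From mathcomp Require Import boolp classical_sets reals.
From mathcomp Require Import mpoly.

Set Implicit Arguments.
Unset Strict Implicit.
Unset Printing Implicit Defensive.

Import GRing.Theory.
Local Open Scope classical_set_scope.
Local Open Scope ring_scope.

Section ProjectiveSpace.
Context {K : fieldType}.

(* Points of the projective space of V are the lines of V through 0. *)
Record proj (V : vectType K) :=
  Proj { proj_vs : {vspace V}; _ : \dim proj_vs == 1%N }.

HB.instance Definition _ (V : vectType K) := [isSub for @proj_vs V].
HB.instance Definition _ (V : vectType K) := [Choice of proj V by <:].

Lemma dim_ppoint (V : vectType K) (v : V) : v != 0 -> \dim <[v]> == 1%N.
Proof. by move=> v0; rewrite dim_vline v0. Qed.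

Definition ppoint (V : vectType K) (v : V) (v0 : v != 0) : proj V :=
  Proj (dim_ppoint v0).

Lemma dim_proj_map (V V' : vectType K) (f : 'Hom(V, V')) (U : {vspace V}) :
  lker f == 0%VS -> \dim (f @: U) = \dim U.
Proof. by move=> /eqP f0; apply: limg_dim_eq; rewrite f0 capv0. Qed.

Lemma proj_map_subproof (V V' : vectType K) (f : 'Hom(V, V'))
  (f_inj : lker f == 0%VS) (p : proj V) : \dim (f @: val p) == 1%N.
Proof. by rewrite dim_proj_map ?(valP p). Qed.

(* The linear embedding [v] |-> [f v] induced by an injective linear map. *)
Definition proj_map (V V' : vectType K) (f : 'Hom(V, V'))
  (f_inj : lker f == 0%VS) (p : proj V) : proj V' :=
  Proj (proj_map_subproof f_inj p).

Lemma proj_map_ppoint (V V' : vectType K) (f : 'Hom(V, V'))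
  (f_inj : lker f == 0%VS) (v : V) (v0 : v != 0) (fv0 : f v != 0) :
  proj_map f_inj (ppoint v0) = ppoint fv0.
Proof. by apply: val_inj; rewrite /= limg_line. Qed.

Definition is_line (V : vectType K) (S : set (proj V)) : Prop :=
  exists U : {vspace V},
    \dim U = 2%N /\ S = [set p : proj V | (val p <= U)%VS].

Definition Pn (n : nat) := proj 'rV[K]_n.+1.

Definition sq_coord n (x : 'rV[K]_n) : 'rV[K]_n := map_mx (fun a => a ^+ 2) x.

Lemma sq_coord_eq0 n (x : 'rV[K]_n) : (sq_coord x == 0) = (x == 0).
Proof.
apply/eqP/eqP => [/rowP x0|->]; apply/rowP => i; rewrite !mxE.
  by have /eqP := x0 i; rewrite !mxE sqrf_eq0 => /eqP.
by rewrite expr0n.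
Qed.

Lemma sq_coord_pick n (p : Pn n) : sq_coord (vpick (val p)) != 0.
Proof. by rewrite sq_coord_eq0 vpick0 -dimv_eq0 (eqP (valP p)). Qed.

(* phi_2, computed on a chosen representative; phi2_ppoint shows that the
   choice is immaterial. *)
Definition phi2 n (p : Pn n) : Pn n := ppoint (sq_coord_pick p).

Lemma phi2_ppoint n (x : 'rV[K]_n.+1) (x0 : x != 0) (x20 : sq_coord x != 0) :
  phi2 (ppoint x0) = ppoint x20.
Proof.
apply: val_inj => /=.
have := memv_pick <[x]>%VS; have := vpick0 <[x]>%VS.
move: (vpick _) => y + /vlineP[a ya]; rewrite {}ya -dimv_eq0 dim_vline x0 /=.
rewrite scaler_eq0 => /norP[a0 _].
have -> : sq_coord (a *: x) = a ^+ 2 *: sq_coord x.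
  by apply/rowP => i; rewrite !mxE exprMn.
apply/eqP; rewrite eqEdim !dim_vline scaler_eq0 expf_eq0 (negbTE a0) /=.
by rewrite (negbTE x20) /= andbT -memvE memvZ ?memv_line.
Qed.

Definition coord_square n (S : set (Pn n)) : set (Pn n) := @phi2 n @` S.

Section LinearForms.
Context (W : vectType K) (n : nat) (l : 'I_n.+1 -> 'Hom(W, K^o)).

Definition eval_forms (w : W) : 'rV[K]_n.+1 := \row_i l i w.

Lemma eval_forms_is_linear : linear eval_forms.
Proof. by move=> a u v; apply/rowP => i; rewrite !mxE linearP. Qed.
HB.instance Definition _ :=
  GRing.isLinear.Build K W 'rV[K]_n.+1 _ eval_forms eval_forms_is_linear.

Definition forms_map : 'Hom(W, 'rV[K]_n.+1) := linfun eval_forms.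

Lemma forms_mapE w : forms_map w = \row_i l i w.
Proof. by rewrite lfunE. Qed.

(* insub <[l i]> is Some [l i] if l i is nonzero and None otherwise. *)
Definition points_of_forms : {fset proj 'Hom(W, K^o)} :=
  [fset p in pmap (fun i => insub <[l i]>%VS : option (proj 'Hom(W, K^o)))
               (enum 'I_n.+1)]%fset.

Lemma points_of_formsP (p : proj 'Hom(W, K^o)) :
  p \in points_of_forms <-> exists i (li0 : l i != 0), p = ppoint li0.
Proof.
rewrite in_fset /= mem_pmap; split.
  case/mapP => i _; case: insubP => // q + qE [->].
  rewrite dim_vline eqb1 => li0.
  by exists i, li0; apply: val_inj.
case=> i [li0 ->]; apply/mapP; exists i; first by rewrite mem_enum.
by rewrite (insubT (fun U => \dim U == 1%N) (dim_ppoint li0)).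
Qed.

End LinearForms.
End ProjectiveSpace.

Arguments Pn K n : clear implicits.

Section Conics.
Context {K : closedFieldType}.

Definition curve (q : {mpoly K[3]}) : set (Pn K 2) :=
  [set p : Pn K 2 | forall v : 'rV[K]_3, v \in val p -> q.@[fun i => v 0 i] = 0].

Definition smooth_conic_form (q : {mpoly K[3]}) : Prop :=
  [/\ q != 0, q \is 2.-homog &
    forall v : 'rV[K]_3, v != 0 -> q.@[fun i => v 0 i] = 0 ->
      exists i : 'I_3, (q^`M(i)).@[fun j => v 0 j] != 0].

(* The plane is the image of an arbitrary linear embedding of P^2. *)
Definition is_smooth_conic n (S : set (Pn K n)) : Prop :=
  exists (f : 'Hom('rV[K]_3, 'rV[K]_n.+1)) (f_inj : lker f == 0%VS)
         (q : {mpoly K[3]}),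
    smooth_conic_form q /\ S = proj_map f_inj @` curve q.

End Conics.

(* Main.v *)
(** If x, y are two non-proportional forms among the l_k, they are coordinates
    on W and l_k = a_k x + b_k y, so L^{o2} is the set of all points
    [a_k^2 x^2 + 2 a_k b_k x y + b_k^2 y^2]_k.  If |Z| = 2, then a_k b_k = 0
    for all k, and (x^2, y^2) ranges over all of K^2, so this is the line
    spanned by (a_k^2)_k and (b_k^2)_k.  If |Z| > 2, some a_k b_k is nonzero,
    so (u, v, w) |-> (a_k^2 u + 2 a_k b_k v + b_k^2 w)_k is injective, and
    L^{o2} is the image of the conic u w = v^2, which (x^2, xy, y^2)
    parametrizes. *)

Require Import Defs.
From HB Require Import structures.
From mathcomp Require Import all_boot all_order all_algebra.
From mathcomp Require Import finmap complex.
From mathcomp Require Import boolp classical_sets reals.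
From mathcomp Require Import ring mpoly.

Set Implicit Arguments.
Unset Strict Implicit.
Unset Printing Implicit Defensive.

Import GRing.Theory.
Local Open Scope classical_set_scope.
Local Open Scope ring_scope.

(** * Coordinate vectors, projective points and independent pairs *)

Section Fields.
Context {K : fieldType}.

Definition rv2 (x y : K) : 'rV[K]_2 := \row_(i < 2) [:: x; y]`_i.
Definition rv3 (x y z : K) : 'rV[K]_3 := \row_(i < 3) [:: x; y; z]`_i.

Lemma rv2_eta (v : 'rV[K]_2) : v = rv2 (v 0 0) (v 0 1).
Proof.
apply/rowP => i; rewrite mxE; case: i => -[|[|//]] i3 /=; congr (v _ _);
  exact: val_inj.
Qed.

Lemma rv3_eta (v : 'rV[K]_3) : v = rv3 (v 0 0) (v 0 1) (v 0 2).
Proof.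
apply/rowP => i; rewrite mxE; case: i => -[|[|[|//]]] i3 /=; congr (v _ _);
  exact: val_inj.
Qed.

Lemma rv2_eq0 (x y : K) : (rv2 x y == 0) = (x == 0) && (y == 0).
Proof.
apply/eqP/andP => [/rowP v0|[/eqP-> /eqP->]].
  by have := v0 0; have := v0 1; rewrite !mxE /= => -> ->.
by apply/rowP => -[[|[|//]] i2]; rewrite !mxE.
Qed.

Lemma rv3_eq0 (x y z : K) :
  (rv3 x y z == 0) = [&& x == 0, y == 0 & z == 0].
Proof.
apply/eqP/and3P => [/rowP v0|[/eqP-> /eqP-> /eqP->]].
  by have := v0 0; have := v0 1; have := v0 2; rewrite !mxE /= => -> -> ->.
by apply/rowP => -[[|[|[|//]]] i2]; rewrite !mxE.
Qed.

Lemma scale_rv3 (c x y z : K) : c *: rv3 x y z = rv3 (c * x) (c * y) (c * z).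
Proof. by apply/rowP => -[[|[|[|//]]] i2]; rewrite !mxE. Qed.

Lemma proj_vlineP (V : vectType K) (p : proj V) :
  exists2 v, v != 0 & val p = <[v]>%VS.
Proof.
exists (vpick (val p)); first by rewrite vpick0 -dimv_eq0 (eqP (valP p)).
apply/esym/eqP; rewrite eqEdim -memvE memv_pick (eqP (valP p)) dim_vline.
by rewrite vpick0 -dimv_eq0 (eqP (valP p)).
Qed.

Lemma ppoint_neq_free (V : vectType K) (u v : V) (u0 : u != 0) (v0 : v != 0) :
  ppoint u0 != ppoint v0 -> free [:: u; v].
Proof.
move=> uv; rewrite free_cons span_seq1 seq1_free v0 andbT.
apply: contra uv; rewrite memvE => uv; apply/eqP/val_inj/eqP => /=.
by rewrite eqEdim uv !dim_vline u0 v0.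
Qed.

(** Serves below to compare coefficients with respect to an independent pair of forms. *)
Lemma free2_eq0 (V : vectType K) (u v : V) (a b : K) :
  free [:: u; v] -> a *: u + b *: v = 0 -> a = 0 /\ b = 0.
Proof.
rewrite free_cons span_seq1 seq1_free => /andP[uv v0] ab0.
have a0 : a = 0.
  apply/eqP; apply: contraNT uv => a0; apply/vlineP; exists (- (a^-1 * b)).
  apply: (scalerI a0); apply/eqP; rewrite -subr_eq0 scalerA mulrN mulVKf //.
  by rewrite scaleNr opprK ab0.
split=> //; move/eqP: ab0; rewrite a0 scale0r add0r scaler_eq0 (negbTE v0) orbF.
by move/eqP.
Qed.

(** The dual of a two-dimensional space has dimension 2, so an independent pair is a basis of it. *)
Lemma dual_span2 (W : vectType K) (f g h : 'Hom(W, K^o)) :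
  \dim {:W} = 2%N -> free [:: f; g] -> exists a b, h = a *: f + b *: g.
Proof.
move=> dimW fg.
have : basis_of fullv [:: f; g].
  rewrite basisEfree fg subvf /= dimvf [dim 'Hom(W, K^o)]/dim /= muln1.
  by rewrite -dimvf dimW.
move/span_basis => fgE; have : h \in fullv := memvf h.
rewrite -fgE span_cons span_seq1 => /memv_addP[u /vlineP[a ->]].
by move=> [v /vlineP[b ->] ->]; exists a, b.
Qed.

(** * Parametrization of the coordinate-wise square of a line *)

Section Forms.
Context (W : vectType K) (n : nat) (l : 'I_n.+1 -> 'Hom(W, K^o)).
Context (l_emb : lker (forms_map l) == 0%VS).

Lemma coord_square_rangeE (p : Pn K n) :
  coord_square (range (proj_map l_emb)) p <->
  exists2 w, w != 0 & val p = <[sq_coord (forms_map l w)]>%VS.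
Proof.
have fw0 w : w != 0 -> forms_map l w != 0.
  by rewrite -!memv_ker (eqP l_emb) memv0.
split=> [[_ [r _ <-] <-]|[w w0 pE]].
  have [w w0 rE] := proj_vlineP r; exists w => //.
  have -> : r = ppoint w0 by apply: val_inj.
  rewrite (proj_map_ppoint _ _ (fw0 _ w0)) phi2_ppoint//.
  by rewrite sq_coord_eq0 fw0.
exists (proj_map l_emb (ppoint w0)); first by exists (ppoint w0).
rewrite (proj_map_ppoint _ _ (fw0 _ w0)) phi2_ppoint.
  by rewrite sq_coord_eq0 fw0.
by move=> fw2; apply: val_inj.
Qed.

Context (dimW : \dim {:W} = 2%N) (f g : 'Hom(W, K^o)) (a b : 'I_n.+1 -> K).
Context (lE : forall k, l k = a k *: f + b k *: g).

(** A common zero of [f] and [g] is a zero of every [l k], hence lies in the trivial kernel of the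
    embedding. *)
Lemma forms_comb_rv2 w : rv2 (f w) (g w) = 0 -> w = 0.
Proof.
move/eqP; rewrite rv2_eq0 => /andP[/eqP fw /eqP gw].
apply/eqP; rewrite -memv0 -(eqP l_emb) memv_ker forms_mapE.
apply/eqP/rowP => k.
by rewrite !mxE lE add_lfunE !scale_lfunE fw gw !scaler0 addr0.
Qed.

(** The map (f, g) from [W] to K^2 is injective, and both spaces have dimension 2. *)
Lemma forms_comb_surj x y : exists w, f w = x /\ g w = y.
Proof.
pose h (i : 'I_2) := [:: f; g]`_i.
have hE w : forms_map h w = rv2 (f w) (g w).
  by rewrite forms_mapE; apply/rowP => -[[|[|//]] i2]; rewrite !mxE.
have h0 : (fullv :&: lker (forms_map h) = 0)%VS.
  apply/eqP; rewrite -subv0; apply/subvP => w /memv_capP[_].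
  by rewrite memv_ker hE => /eqP/forms_comb_rv2->; rewrite mem0v.
have hT : limg (forms_map h) = fullv.
  by apply/eqP; rewrite eqEdim subvf limg_dim_eq // dimW dimvf dim_matrix.
have : rv2 x y \in limg (forms_map h) by rewrite hT memvf.
case/memv_imgP => w _; rewrite hE => /rowP vE; exists w.
by have := vE 0; have := vE 1; rewrite !mxE.
Qed.

(** Since (f, g) identifies [W] with K^2, nonzero vectors of [W] may be traded for nonzero pairs (x,
    y). Both cases of the theorem start from this parametrization. *)
Lemma coord_square_binaryE (p : Pn K n) :
  coord_square (range (proj_map l_emb)) p <->
  exists x y, rv2 x y != 0 /\
    val p = <[\row_k (a k * x + b k * y) ^+ 2]>%VS.
Proof.
have wE w : sq_coord (forms_map l w) = \row_k (a k * f w + b k * g w) ^+ 2.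
  by apply/rowP => k; rewrite forms_mapE !mxE lE add_lfunE !scale_lfunE.
rewrite coord_square_rangeE; split=> [[w w0]|[x [y [xy0 ->]]]].
  rewrite wE => pE; exists (f w), (g w); split=> //.
  by apply: contra w0 => /eqP/forms_comb_rv2->.
have [w [fw gw]] := forms_comb_surj x y.
exists w; last by rewrite wE fw gw.
apply: contra xy0 => /eqP w0; rewrite -fw -gw w0 !linear0.
by rewrite rv2_eq0 eqxx.
Qed.

End Forms.
End Fields.

(** * Recognizing lines and conics over an algebraically closed field *)

Section ClosedFields.
Context {K : closedFieldType}.

Lemma closed_sqrt (c : K) : exists x, x ^+ 2 = c.
Proof.
(* The monic equation solved here is x^2 = c + 0 x. *)
have [x] := @solve_monicpoly K 2 (fun i => if i == 0%N then c else 0) isT.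
by rewrite !big_ord_recl big_ord0 /= mul0r !addr0 expr0 mulr1; exists x.
Qed.

(** Square roots exist, so (x^2, y^2) reaches every nonzero vector of K^2 and [S] fills the whole
    line of the plane [limg g]. *)
Lemma is_line_squares n (g : 'Hom('rV[K]_2, 'rV[K]_n.+1)) (S : set (Pn K n)) :
  lker g == 0%VS ->
  (forall p, S p <-> exists x y, rv2 x y != 0 /\
     val p = <[g (rv2 (x ^+ 2) (y ^+ 2))]>%VS) ->
  is_line S.
Proof.
move=> g_inj SE; exists (limg g); split.
  by rewrite dim_proj_map // dimvf dim_matrix.
apply/seteqP; split=> p; rewrite SE.
  by move=> [x [y [_ pE]]]; rewrite /mkset pE -memvE memv_img ?memvf.
have [v v0 pE] := proj_vlineP p.
rewrite /mkset pE -memvE => /memv_imgP[u _ vE]; rewrite vE in v0 *.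
have [x xE] := closed_sqrt (u 0 0); have [y yE] := closed_sqrt (u 0 1).
exists x, y; rewrite xE yE -rv2_eta; split=> //.
apply: contra v0; rewrite rv2_eq0 => /andP[/eqP x0 /eqP y0].
suff /eqP-> : u == 0 by rewrite linear0.
by rewrite [u]rv2_eta rv2_eq0 -xE -yE x0 y0 expr0n eqxx.
Qed.

Definition veronese_form : {mpoly K[3]} := 'X_0 * 'X_2 - 'X_1 ^+ 2.

Lemma veronese_formE (v : 'rV[K]_3) :
  veronese_form.@[fun i => v 0 i] = v 0 0 * v 0 2 - v 0 1 ^+ 2.
Proof. by rewrite mevalB mevalM rmorphXn /= !mevalXU. Qed.

(** The gradient of u w - v^2 is (w, -2 v, u), which vanishes only at the origin when 2 is
    invertible. *)
Lemma veronese_smooth : (2 : K) != 0 -> smooth_conic_form veronese_form.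
Proof.
move=> two0; split.
(* The form takes the value 1 at (1, 0, 1). *)
- apply/eqP => q0; have := veronese_formE (rv3 1 0 1).
  rewrite q0 meval0 !mxE /= mulr1 expr0n subr0 => /eqP.
  by rewrite eq_sym oner_eq0.
- have X1 i : ('X_i : {mpoly K[3]}) \is 1.-homog.
    by rewrite dhomogX /= mdeg1.
  by rewrite rpredB ?expr2 // -[2%N]/(1 + 1)%N dhomogM.
move=> v v0 _; apply/existsP; apply: contraNT v0 => /existsPn v0.
have X (i j : 'I_3) : ('X_i : {mpoly K[3]})^`M(j) = ((i == j)%:R)%:MP.
  rewrite mderivX mnm1E; case: eqP => [->|_]; last by rewrite scale0r mpolyC0.
  rewrite scale1r (_ : (_ - _)%MM = 0%MM) ?mpolyX0 //.
  by apply/mnmP => k; rewrite mnmBE mnm0E subnn.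
have D j : (veronese_form^`M(j)).@[fun i => v 0 i] =
    (0 == j)%:R * v 0 2 + v 0 0 * (2 == j)%:R
    - ((1 == j)%:R * v 0 1 + v 0 1 * (1 == j)%:R).
  rewrite mderivB expr2 !mderivM !X mevalB !mevalD !mevalM !mevalXU !mevalC.
  by [].
have := v0 0; have := v0 1; have := v0 2; rewrite !D !negbK /=.
rewrite !(mul0r, mulr0, mul1r, mulr1, add0r, addr0, oppr0, subr0) -mulr2n.
rewrite oppr_eq0 -(mulr_natr (v 0 1)) mulf_eq0 (negbTE two0) orbF => v2 v1 v00.
by rewrite [v]rv3_eta rv3_eq0 v2 v1 v00.
Qed.

Lemma is_smooth_conic_veronese n (f : 'Hom('rV[K]_3, 'rV[K]_n.+1))
    (S : set (Pn K n)) :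
  (2 : K) != 0 -> lker f == 0%VS ->
  (forall p, S p <-> exists x y, rv2 x y != 0 /\
     val p = <[f (rv3 (x ^+ 2) (x * y) (y ^+ 2))]>%VS) ->
  is_smooth_conic S.
Proof.
move=> two0 f_inj SE; exists f, f_inj, veronese_form.
split; first exact: veronese_smooth.
apply/seteqP; split=> p; rewrite SE.
  move=> [x [y [xy0 pE]]].
  have v0 : rv3 (x ^+ 2) (x * y) (y ^+ 2) != 0.
    apply: contra xy0; rewrite rv3_eq0 rv2_eq0 !sqrf_eq0.
    by case/and3P => -> _ ->.
  exists (ppoint v0); last by apply: val_inj; rewrite /= limg_line.
  move=> _ /vlineP[c ->]; rewrite veronese_formE scale_rv3 !mxE /=.
  by ring.
move=> [r rC <-]; have [v v0 rE] := proj_vlineP r.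
have := rC v; rewrite rE memv_line veronese_formE => /(_ isT) /eqP.
rewrite subr_eq0 => /eqP vC.
have [x xE] := closed_sqrt (v 0 0); have [z zE] := closed_sqrt (v 0 2).
(* The roots x and z of the outer coordinates satisfy (x z)^2 = v_1^2 on the conic, so x z is v_1 up
   to sign; the sign is absorbed into y. *)
have [y yE xyE] : exists2 y, y ^+ 2 = v 0 2 & x * y = v 0 1.
  have /eqP : (x * z) ^+ 2 = v 0 1 ^+ 2 by rewrite exprMn xE zE.
  rewrite eqf_sqr => /orP[/eqP xz|/eqP xz]; first by exists z.
  by exists (- z); rewrite ?sqrrN // mulrN xz opprK.
exists x, y; rewrite xE yE xyE -rv3_eta /= rE limg_line; split=> //.
apply: contra v0; rewrite rv2_eq0 => /andP[/eqP x0 /eqP y0].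
by rewrite [v]rv3_eta rv3_eq0 -xE -yE -xyE x0 y0 mul0r expr0n !eqxx.
Qed.

(** * The two cases of the theorem *)

Section CoordSquare.
Context (n : nat) (W : vectType K) (l : 'I_n.+1 -> 'Hom(W, K^o)).
Context (dimW : \dim {:W} = 2%N) (l_emb : lker (forms_map l) == 0%VS).

(** Uniqueness of coefficients forces the values at [i] and [j]. Thanks to them, coordinates [i] and
    [j] of the maps built below isolate single entries of their argument, which gives
    injectivity. *)
Lemma forms_comb_free i j : free [:: l i; l j] ->
  exists a b : 'I_n.+1 -> K, [/\ forall k, l k = a k *: l i + b k *: l j,
    a i = 1 /\ b i = 0 & a j = 0 /\ b j = 1].
Proof.
move=> ij; have ex k := dual_span2 (l k) dimW ij.
have [a ea] := choice ex; have [b lE] := choice ea.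
exists a, b; split=> //.
  have [|a1 b0] := @free2_eq0 _ _ _ _ (a i - 1) (b i) ij.
    by rewrite scalerBl scale1r addrAC -lE subrr.
  by split=> //; apply/eqP; rewrite -subr_eq0 a1.
have [|a0 b1] := @free2_eq0 _ _ _ _ (a j) (b j - 1) ij.
  by rewrite scalerBl scale1r addrA -lE subrr.
by split=> //; apply/eqP; rewrite -subr_eq0 b1.
Qed.

Lemma coord_square_line : #|` points_of_forms l|%fset = 2%N ->
  is_line (coord_square (range (proj_map l_emb))).
Proof.
move=> Z2.
have [p [q [ZE pq]]] : exists p q,
    (forall z, (z \in points_of_forms l) = (z \in [:: p; q])) /\ p != q.
  have := fset_uniq (points_of_forms l); move: Z2.
  have : forall z, (z \in points_of_forms l) =
    (z \in enum_fset (points_of_forms l)) by [].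
  case: (enum_fset _) => [|p [|q [|r s]]] //= sZ _.
  by rewrite inE andbT; exists p, q.
have /points_of_formsP[i [li0 pE]] : p \in points_of_forms l.
  by rewrite ZE !inE eqxx.
have /points_of_formsP[j [lj0 qE]] : q \in points_of_forms l.
  by rewrite ZE !inE eqxx orbT.
have ij : free [:: l i; l j].
  by apply: (@ppoint_neq_free _ _ _ _ li0 lj0); rewrite -pE -qE.
have [a [b [lE [ai bi] [aj bj]]]] := forms_comb_free ij.
(* Each [l k] is zero or proportional to [l i] or [l j], as there are no other points; comparing
   coefficients kills [a k] or [b k]. *)
have ab k : a k * b k = 0.
  have [lk0|lk0] := eqVneq (l k) 0.
    by have [|-> _] := @free2_eq0 _ _ _ _ (a k) (b k) ij;
      rewrite ?mul0r // -lE lk0.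
  have : ppoint lk0 \in points_of_forms l.
    by apply/points_of_formsP; exists k, lk0.
  rewrite ZE !inE pE qE => /orP[] /eqP /(congr1 val) /= kE.
    have /vlineP[c] : l k \in <[l i]>%VS by rewrite -kE memv_line.
    rewrite lE => cE; have [|_ ->] := @free2_eq0 _ _ _ _ (a k - c) (b k) ij.
      by rewrite scalerBl addrAC cE subrr.
    by rewrite mulr0.
  have /vlineP[c] : l k \in <[l j]>%VS by rewrite -kE memv_line.
  rewrite lE => cE; have [|-> _] := @free2_eq0 _ _ _ _ (a k) (b k - c) ij.
    by rewrite scalerBl addrA cE subrr.
  by rewrite mul0r.
pose M : 'M[K]_(2, n.+1) := \matrix_(r, k) [:: a k ^+ 2; b k ^+ 2]`_r.
pose g : 'Hom('rV[K]_2, 'rV[K]_n.+1) := linfun (mulmxr M).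
have gE v k : g v 0 k = v 0 0 * a k ^+ 2 + v 0 1 * b k ^+ 2.
  rewrite lfunE /= mxE !big_ord_recl big_ord0 addr0 !mxE /=.
  by congr (v _ _ * _ + v _ _ * _); apply: val_inj.
apply: (@is_line_squares _ g).
  rewrite -subv0; apply/subvP => v; rewrite memv_ker memv0 => /eqP/rowP v0.
  (* Coordinates [i] and [j] of [g v] are the two entries of [v]. *)
  have := v0 i; have := v0 j; rewrite !gE !mxE ai bi aj bj.
  rewrite expr1n expr0n /= !mulr0 !mulr1 addr0 add0r => v1 v00.
  by rewrite [v]rv2_eta rv2_eq0 v1 v00 eqxx.
move=> r; rewrite (coord_square_binaryE _ dimW lE).
suff gs x y : g (rv2 (x ^+ 2) (y ^+ 2)) = \row_k (a k * x + b k * y) ^+ 2.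
  by split=> -[x [y [xy0 rE]]]; exists x, y; split=> //; rewrite rE gs.
apply/rowP => k; rewrite gE !mxE /=.
(* The cross term contains the factor [a k * b k], which is zero. *)
rewrite sqrrD (mulrACA (a k)) ab mul0r mul0rn addr0 !exprMn.
by congr (_ + _); exact: mulrC.
Qed.

Lemma coord_square_conic :
  (2 : K) != 0 -> (2 < #|` points_of_forms l|)%fset%N ->
  is_smooth_conic (coord_square (range (proj_map l_emb))).
Proof.
move=> two0 Z3.
have [p [q [r [Zpqr pq pr qr]]]] : exists p q r,
    [/\ {subset [:: p; q; r] <= points_of_forms l}, p != q, p != r & q != r].
  have := fset_uniq (points_of_forms l); move: Z3.
  have : {subset enum_fset (points_of_forms l) <= points_of_forms l} by [].
  case: (enum_fset _) => [|p [|q [|r s]]] //= sZ _.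
  rewrite !inE !negb_or => /and3P[/and3P[pq pr _] /andP[qr _] _].
  exists p, q, r; split=> // z zE; apply: sZ; move: zE; rewrite !inE.
  by case/or3P => ->; rewrite ?orbT.
have /points_of_formsP[i [li0 pE]] : p \in points_of_forms l.
  by rewrite Zpqr // !inE eqxx.
have /points_of_formsP[j [lj0 qE]] : q \in points_of_forms l.
  by rewrite Zpqr // !inE eqxx orbT.
have /points_of_formsP[k [lk0 rE]] : r \in points_of_forms l.
  by rewrite Zpqr // !inE eqxx !orbT.
rewrite {}pE {}qE {}rE in pq pr qr.
have [a [b [lE [ai bi] [aj bj]]]] := forms_comb_free (ppoint_neq_free pq).
(* If [a k] vanished, [l k] would be a multiple of [l j], against [qr]; symmetrically, [b k] is
   nonzero by [pr]. *)
have ak0 : a k != 0.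
  apply: contraTneq (ppoint_neq_free qr) => ak.
  rewrite [l k]lE ak scale0r add0r free_cons span_seq1 seq1_free negb_and.
  rewrite negbK scaler_eq0; have [->|bk0] := eqVneq (b k) 0; rewrite ?orbT //.
  by rewrite -[X in X \in _](scalerK bk0) memvZ ?memv_line.
have bk0 : b k != 0.
  apply: contraTneq (ppoint_neq_free pr) => bk.
  rewrite [l k]lE bk scale0r addr0 free_cons span_seq1 seq1_free negb_and.
  rewrite negbK scaler_eq0; have [->|ak0'] := eqVneq (a k) 0; rewrite ?orbT //.
  by rewrite -[X in X \in _](scalerK ak0) memvZ ?memv_line.
pose M : 'M[K]_(3, n.+1) :=
  \matrix_(s, m) [:: a m ^+ 2; 2 * a m * b m; b m ^+ 2]`_s.
pose f : 'Hom('rV[K]_3, 'rV[K]_n.+1) := linfun (mulmxr M).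
have fE v m : f v 0 m =
    v 0 0 * a m ^+ 2 + v 0 1 * (2 * a m * b m) + v 0 2 * b m ^+ 2.
  rewrite lfunE /= mxE !big_ord_recl big_ord0 addr0 !mxE /= addrA.
  by congr (v _ _ * _ + v _ _ * _ + v _ _ * _); apply: val_inj.
apply: (@is_smooth_conic_veronese _ f) => //.
  rewrite -subv0; apply/subvP => v; rewrite memv_ker memv0 => /eqP/rowP v0.
  (* Coordinates [i] and [j] kill the outer entries of [v]; coordinate [k] then reads 2 a_k b_k v_1
     = 0, where the factor 2 a_k b_k is nonzero. *)
  have := v0 i; have := v0 j; have := v0 k; rewrite !fE !mxE ai bi aj bj.
  rewrite expr1n expr0n /= !(mulr0, mulr1, mul0r, addr0, add0r).
  move=> vk v2 v00; move: vk; rewrite v2 v00 !mul0r add0r addr0 => /eqP.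
  rewrite !mulf_eq0 (negbTE two0) (negbTE ak0) (negbTE bk0) !orbF => v1.
  by rewrite [v]rv3_eta rv3_eq0 v00 v2 v1 !eqxx.
move=> s; rewrite (coord_square_binaryE _ dimW lE).
suff fs x y : f (rv3 (x ^+ 2) (x * y) (y ^+ 2)) =
    \row_k (a k * x + b k * y) ^+ 2.
  by split=> -[x [y [xy0 sE]]]; exists x, y; split=> //; rewrite sE fs.
by apply/rowP => m; rewrite fE !mxE /=; ring.
Qed.

End CoordSquare.
End ClosedFields.

Theorem theorem4p6 (R : realType) (n : nat) (L : set (Pn R[i] n))
  (W : vectType R[i]) (l : 'I_n.+1 -> 'Hom(W, R[i]^o))
  (dimW : \dim {:W} = 2%N)
  (l_emb : lker (forms_map l) == 0%VS)
  (L_line : is_line L)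
  (L_img : L = range (proj_map l_emb)) :
  (#|` points_of_forms l|%fset = 2%N -> is_line (coord_square L)) /\
  ((2 < #|` points_of_forms l|%fset)%N -> is_smooth_conic (coord_square L)).
Proof.
rewrite L_img; split; first exact: coord_square_line.
(* 2 is nonzero because [R[i]] has characteristic zero. *)
by apply: coord_square_conic => //; rewrite Num.Theory.pnatr_eq0.
Qed.
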